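(* Let $G$ be a graph whose edges are colored red and blue. Then $V(G)$ can be partitioned into at most $2\alpha(G)$ parts, where each part is either the vertex set of a single edge, or a single vertex, or is spanned by a monochromatic connected matching, or contains a monochromatic spanning cycle.
   Context: $\alpha(G)$ is the independence number of $G$. A monochromatic (say red) connected matching is a matching consisting of red edges all of which lie in the same connected component of the graph formed by the red edges; a part is spanned by it if the part equals the set of vertices covered by the matching. A monochromatic spanning cycle of a part is a cycle all of whose edges have the same color and whose vertex set is the whole part. *)

(* Defs.v *)
From mathcomp Require Import all_boot.

Set Implicit Arguments.
Unset Strict Implicit.
Unset Printing Implicit Defensive.

(* A finite simple graph is a symmetric irreflexive relation [e] on a finType.
   Edge colorings are functions on two-element vertex sets with values in
   [bool] ([true] is red, [false] is blue); only values on edges matter. *)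

Section Graphs.

Variables (T : finType) (e : rel T).

Definition independent (S : {set T}) : bool :=
  [forall x in S, forall y in S, ~~ e x y].

Definition alpha : nat := \max_(S : {set T} | independent S) #|S|.

Definition is_edge (A : {set T}) : bool :=
  [exists x, exists y, e x y && (A == [set x; y])].

Definition is_matching (M : {set {set T}}) : Prop :=
  (forall A, A \in M -> is_edge A) /\ trivIset M.

(* Connectivity is taken in [e] on all of [T], not in a subgraph induced on
   the vertices covered by [M]. *)
Definition is_connected_matching (M : {set {set T}}) : Prop :=
  is_matching M /\ {in cover M &, forall x y, connect e x y}.

Definition spanned_by_connected_matching (A : {set T}) : Prop :=
  exists M : {set {set T}}, is_connected_matching M /\ cover M = A.

(* [ucycle e s] also holds when [s] is empty or traverses one edge twice. *)
Definition has_spanning_cycle (A : {set T}) : Prop :=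
  exists s : seq T, [/\ 2 < size s, ucycle e s & [set x in s] = A].

End Graphs.

Definition color_graph (T : finType) (e : rel T) (c : {set T} -> bool)
    (k : bool) : rel T :=
  [rel x y | e x y && (c [set x; y] == k)].

(* Main.v *)
(* By König's theorem, applied to the bipartite multigraph whose two sides are
   the red and the blue components and whose edges are the vertices of G, some
   set J of at most alpha(G) monochromatic components covers V(G): a matching
   there is a set of vertices with pairwise distinct red and blue components,
   hence independent in G.  Take a maximum matching M among the edges that lie,
   with their color, in a component of J; it splits into at most alpha(G)
   monochromatic connected matchings.  An uncovered vertex lies in a component
   of J of some color, so by maximality all its edges to other uncovered
   vertices have the opposite color.  Hence every cycle on uncovered vertices
   is monochromatic, and by Posa's theorem the uncovered vertices split into at
   most alpha(G) cycles, edges and vertices. *)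

Require Import Defs.
From mathcomp Require Import all_boot.
From mathcomp Require Import zify.

Set Implicit Arguments.
Unset Strict Implicit.
Unset Printing Implicit Defensive.

(** * König's theorem for bipartite multigraphs *)

Lemma imset_transversal (T : finType) (R : finType) (g : T -> R) (E : {set T}) :
  exists I : {set T},
    [/\ I \subset E, {in I &, injective g} & g @: I = g @: E].
Proof.
(* [rep x] depends on [x] only through [g x], so the points that represent themselves meet each
   fibre of [g] on [E] exactly once. *)
pose rep x := [pick z in E | g z == g x].
have rep_eq x y : g x = g y -> rep x = rep y by rewrite /rep => ->.
exists [set x | rep x == Some x]; split.
- apply/subsetP=> x; rewrite inE /rep.
  by case: pickP => // z /andP[Ez _] /eqP[<-].
- move=> x y; rewrite !inE => /eqP rx /eqP ry /rep_eq.
  by rewrite rx ry => -[].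
apply/setP=> y; apply/imsetP/imsetP=> -[x].
  rewrite inE /rep; case: pickP => // z /andP[Ez _] /eqP[<-] ->.
  by exists z.
move=> Ex ->; have [z rx gz] : exists2 z, rep x = Some z & g z = g x.
  rewrite /rep; case: pickP => [z /andP[_ /eqP gz]|/(_ x)]; first by exists z.
  by rewrite Ex eqxx.
by exists z => //; rewrite inE (rep_eq z x) // rx.
Qed.

(* Rado's argument: shrink the edge set while the deficiency version of Hall's
   condition holds; by submodularity a minimal edge set has at most one edge at
   each left vertex. *)
Lemma konig (T L R : finType) (f : T -> L) (g : T -> R) :
  exists (I : {set T}) (A : {set L}) (B : {set R}),
    [/\ {in I &, injective f}, {in I &, injective g}, #|A| + #|B| <= #|I| &
        forall x, (f x \in A) || (g x \in B)].
Proof.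
pose N (E : {set T}) (S : {set L}) := g @: [set x in E | f x \in S].
(* The left vertices [~: S] and the right vertices [N E S] cover all edges in [E]; [w E S] is the
   size of this cover. *)
pose w E S := #|N E S| + #|~: S|.
case: (@arg_minnP _ set0 predT (w [set: T]) isT) => S0 _ S0min.
(* Passing from all edges to [E] does not lower the least size of such a cover. *)
pose hall E := [forall S, w [set: T] S0 <= w E S].
have hallT : hall [set: T] by apply/forallP=> S; apply: S0min.
have [E /minsetP[/forallP hallE Emin] _] := minset_exists hallT.
have finj : {in E &, injective f}.
  move=> x1 x2 Ex1 Ex2 fx; apply/eqP/negPn/negP=> nx.
  have tight x : x \in E ->
      exists2 S : {set L}, f x \in S & w (E :\ x) S < w [set: T] S0.
    move=> Ex; have : ~~ hall (E :\ x).
      apply/negP=> /Emin /(_ (subD1set _ _)) defE.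
      by move: Ex; rewrite -defE !inE eqxx.
    rewrite negb_forall => /existsP[S]; rewrite -ltnNge => ltS.
    exists S => //; apply/negPn/negP=> nS.
    have := leq_trans ltS (hallE S); rewrite /w.
    suff -> : N (E :\ x) S = N E S by rewrite ltnn.
    rewrite /N; suff -> : [set z in E :\ x | f z \in S] = [set z in E | f z \in S].
      by [].
    apply/setP=> z; rewrite !inE.
    by case: (eqVneq z x) => [->|_] //=; rewrite (negPf nS) andbF.
  have [S1 fS1 lt1] := tight _ Ex1; have [S2 fS2 lt2] := tight _ Ex2.
  (* Without [f x1] the intersection sees neither [x1] nor [x2]. This costs 1, while the two strict
     inequalities gain 2. *)
  have := leq_add (hallE (S1 :|: S2)) (hallE (S1 :&: S2 :\ f x1)).
  have leU : #|N E (S1 :|: S2)| <= #|N (E :\ x1) S1 :|: N (E :\ x2) S2|.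
    rewrite -imsetU; apply/subset_leq_card/imsetS/subsetP=> z.
    rewrite !inE => /andP[-> /orP[] fz]; rewrite fz /= !andbT.
    - case: (eqVneq z x1) => [->|] //=.
      by rewrite fx fS2 nx.
    - case: (eqVneq z x2) => [->|] /=; last by rewrite orbT.
      by rewrite -fx fS1 eq_sym nx.
  have leI : #|N E (S1 :&: S2 :\ f x1)| <=
      #|N (E :\ x1) S1 :&: N (E :\ x2) S2|.
    apply/subset_leq_card/subsetP=> _ /imsetP[z + ->].
    rewrite !inE => /and4P[Ez nz z1 z2].
    rewrite !imset_f // !inE Ez ?z1 ?z2 !andbT;
      by apply: contraNneq nz => ->; rewrite ?fx.
  have leC : #|~: (S1 :&: S2 :\ f x1)| <= #|~: S1 :|: ~: S2|.+1.
    rewrite setDE setCI setCK setCI setUC.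
    by rewrite (leq_trans (leq_card_setU _ _).1) ?cards1.
  move: lt1 lt2; rewrite /w setCU.
  have := cardsUI (N (E :\ x1) S1) (N (E :\ x2) S2).
  have := cardsUI (~: S1) (~: S2).
  lia.
have [I [/subsetP subI ginj gI]] := imset_transversal g E.
exists I, (~: S0), (N [set: T] S0); split=> //.
- by move=> x y /subI Ex /subI Ey; apply: finj.
- rewrite addnC -(card_in_imset ginj) gI.
  (* For [S = setT] the left side of the cover is empty, so [g @: E] alone has at least the size of
     the least cover. *)
  have := hallE setT; rewrite {2}/w /N setCT cards0 addn0.
  suff -> : [set z in E | f z \in setT] = E by [].
  by apply/setP=> z; rewrite !inE andbT.
move=> x; rewrite inE; case: (boolP (f x \in S0)) => //= fx.
by rewrite imset_f // !inE.
Qed.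

Lemma partition_setU (T : finType) (P Q : {set {set T}}) (A B : {set T}) :
  [disjoint A & B] -> partition P A -> partition Q B ->
  partition (P :|: Q) (A :|: B).
Proof.
move=> dAB /and3P[/eqP cP tP P0] /and3P[/eqP cQ tQ Q0]; apply/and3P; split.
- by rewrite /cover bigcup_setU -!/(cover _) cP cQ.
- by apply: trivIsetU; rewrite // cP cQ.
by rewrite inE negb_or P0.
Qed.

(** * Posa's theorem: cycles, edges and vertices against independent sets *)

Section Posa.

Variables (T : finType) (e : rel T).
Hypotheses (e_sym : symmetric e) (e_irr : irreflexive e).

(** Prepend neighbours of the head that lie in [U] off the path until none is left; [#|U|] bounds
    the length. *)
Lemma path_absorbing_head (U : {set T}) x : x \in U ->
  exists y p, [/\ path e y p, uniq (y :: p), {subset y :: p <= U} &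
                  forall z, z \in U -> e y z -> z \in p].
Proof.
move=> Ux.
suff grow n y p : #|U| - size p <= n -> path e y p -> uniq (y :: p) ->
    {subset y :: p <= U} ->
    exists y p, [/\ path e y p, uniq (y :: p), {subset y :: p <= U} &
                  forall z, z \in U -> e y z -> z \in p].
  apply: (grow _ x [::] (leqnn _)) => // z; by rewrite inE => /eqP->.
elim: n y p => [|n IHn] y p le_n pth un sub.
  have := uniq_leq_size un (s2 := enum U).
  rewrite -cardE => /(_ _)/wrap[z /sub|]; first by rewrite mem_enum.
  by move=> /=; lia.
have [|none] := boolP [exists z in U, e y z && (z \notin y :: p)].
  case/existsP=> z /and3P[Uz eyz zp]; apply: (IHn z (y :: p)) => /=.
  - by move: le_n; rewrite /=; lia.
  - by rewrite e_sym eyz.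
  - by rewrite zp.
  - by move=> t; rewrite inE => /predU1P[->|/sub].
exists y, p; split=> // z Uz eyz; apply: contraNT none => zp.
apply/existsP; exists z; rewrite Uz eyz /= inE negb_or zp andbT.
by apply: contraTneq eyz => ->; rewrite e_irr.
Qed.

(** Dropping non-neighbours of [x] from the right end stops at its last neighbour on [p], or at the
    empty prefix. *)
Lemma path_trim x p : path e x p ->
  exists2 q, prefix q p &
    (q = [::] \/ e x (last x q)) /\ {in p, forall z, e x z -> z \in q}.
Proof.
elim/last_ind: p => [|p z IHp]; first by exists [::] => //; split; [left|].
rewrite rcons_path => /andP[/IHp[q qp [qlast qin]] _].
have [exz|nexz] := boolP (e x z).
  by exists (rcons p z); [apply: prefix_refl | split=> //; right; rewrite last_rcons].
exists q; first by apply: prefix_trans qp (prefix_rcons _ _).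
split=> // t; rewrite mem_rcons inE => /predU1P[-> /(negP nexz)//|].
exact: qin.
Qed.

(* Cutting a maximal path just after the last neighbour of its head leaves a
   cycle, an edge or a vertex that contains all neighbours of the head; remove
   it and add the head to the independent set. *)
Theorem posa (U : {set T}) :
  exists (P : {set {set T}}) (I : {set T}),
    [/\ partition P U, I \subset U, independent e I, #|P| <= #|I| &
        forall A, A \in P ->
          [\/ is_edge e A, exists x, A = [set x] | has_spanning_cycle e A]].
Proof.
elim: {U}_.+1 {-2}U (ltnSn #|U|) => // n IHn U leU.
have [->|[x0 Ux0]] := set_0Vmem U.
  exists set0, set0; split; rewrite ?sub0set ?cards0 //.
  - by rewrite partition_set0.
  - by apply/forallP=> x; rewrite inE.
  by move=> A; rewrite inE.
have [x [p [pth un sub nbr]]] := path_absorbing_head Ux0.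
have [q /prefixP[r def_p] [qlast qin]] := path_trim pth.
pose C := [set z in x :: q].
have xC : x \in C by rewrite !inE eqxx.
have CU : C \subset U.
  apply/subsetP=> z; rewrite inE => zq; apply: sub.
  by rewrite def_p -cat_cons mem_cat zq.
have pthq : path e x q by move: pth; rewrite def_p cat_path => /andP[].
have unq : uniq (x :: q).
  by move: un; rewrite def_p -cat_cons cat_uniq => /andP[].
(* From two vertices in [q] on, the edge from the last one back to [x] closes a genuine cycle. *)
have Cok : [\/ is_edge e C, exists x, C = [set x] | has_spanning_cycle e C].
  case: (q) qlast pthq unq @C {xC CU qin def_p} => [|y [|z s]] qlast pthq unq C.
  - by constructor 2; exists x; apply/setP=> z; rewrite !inE.
  - constructor 1; apply/existsP; exists x; apply/existsP; exists y.
    move: pthq => /= /andP[-> _]; apply/eqP/setP=> z.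
    by rewrite !inE.
  - constructor 3; exists [:: x, y, z & s]; split=> //.
    rewrite /ucycle unq andbT; case: qlast => // elast.
    have -> : cycle e [:: x, y, z & s] = path e x (rcons [:: y, z & s] x) by [].
    by rewrite rcons_path; apply/andP; rewrite e_sym.
have ltD : #|U :\: C| < n.
  rewrite -ltnS; apply: leq_trans leU; rewrite ltnS; apply/proper_card/properP.
  by split; [apply: subsetDl | exists x; rewrite ?inE ?(subsetP CU) ?eqxx].
have [P [I [partP subI indI leP Pok]]] := IHn _ ltD.
have xI : x \notin I by apply/negP=> /(subsetP subI); rewrite inE xC.
have nbrI z : z \in I -> ~~ e x z.
  move=> /(subsetP subI); rewrite inE => /andP[zC Uz].
  apply: contraNN zC => exz.
  by rewrite !inE (qin _ (nbr _ Uz exz) exz) orbT.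
exists (C |: P), (x |: I); split.
- rewrite -(setID U C) (setIidPr CU); apply: partitionU1 => //.
    by apply/set0Pn; exists x.
  by rewrite disjoint_sym disjoints_subset setDE subsetIr.
- by rewrite subUset sub1set (subsetP CU) // (subset_trans subI) ?subsetDl.
- apply/'forall_implyP=> y yI; apply/'forall_implyP=> z.
  move: yI; rewrite !inE => /predU1P[->|Iy] /predU1P[->|Iz].
  + by rewrite e_irr.
  + exact: nbrI.
  + by rewrite e_sym nbrI.
  + by move/'forall_implyP: indI => /(_ y Iy)/'forall_implyP/(_ z Iz).
- by rewrite !cardsU1 xI leq_add // leq_b1.
by move=> A; rewrite !inE => /predU1P[->|/Pok].
Qed.

End Posa.

(** * Monochromatic components and cycles *)

Section TwoColored.

Variables (T : finType) (e : rel T) (c : {set T} -> bool).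
Hypotheses (e_sym : symmetric e) (e_irr : irreflexive e).

Let component k := root (color_graph e c k).

Lemma color_graph_sym k : symmetric (color_graph e c k).
Proof. by move=> x y; rewrite /color_graph /= e_sym setUC. Qed.

Lemma component_eqP k x y :
  reflect (component k x = component k y) (connect (color_graph e c k) x y).
Proof. exact: (rootP (sym_connect_sym (@color_graph_sym k))). Qed.

Lemma component_edge x y :
  e x y -> component (c [set x; y]) x = component (c [set x; y]) y.
Proof. by move=> exy; apply/component_eqP/connect1; rewrite /color_graph /= exy eqxx. Qed.

Lemma leq_alpha (S : {set T}) : independent e S -> #|S| <= alpha e.
Proof. by move=> indS; rewrite /alpha (bigD1 S) //= leq_maxl. Qed.

Lemma components_cover :
  exists2 J : {set bool * T}, #|J| <= alpha e &
    forall x, exists k, (k, component k x) \in J.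
Proof.
have [I [A [B [redI blueI leI cov]]]] := konig (component true) (component false).
(* The colour tag is essential: one root may name both a red and a blue component. *)
exists ([set (true, a) | a in A] :|: [set (false, b) | b in B]).
  apply: leq_trans (leq_card_setU _ _).1 _.
  apply: leq_trans (leq_add (leq_imset_card _ _) (leq_imset_card _ _)) _.
  apply: leq_trans leI (leq_alpha _).
  apply/'forall_implyP=> x Ix; apply/'forall_implyP=> y Iy.
  apply/negP=> exy; have := component_edge exy.
  have nxy : x <> y by move=> xy; rewrite xy e_irr in exy.
  by case: (c _) => [/redI|/blueI] /(_ Ix Iy).
move=> x; case/orP: (cov x) => inJ; [exists true | exists false];
  by rewrite inE !imset_f ?orbT.
Qed.

(** Either end of an edge inside [U] determines its colour, so [j] agrees at both ends and is
    constant along the cycle. *)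
Lemma spanning_cycle_color (j : T -> bool) (U A : {set T}) :
  {in U &, forall x y, e x y -> c [set x; y] = j x} -> A \subset U ->
  has_spanning_cycle e A -> exists k, has_spanning_cycle (color_graph e c k) A.
Proof.
move=> jU /subsetP AU [[|x p] [// sz /andP[cyc un] defA]].
have jE : {in U &, forall y z, e y z -> j y = j z}.
  by move=> y z Uy Uz eyz; rewrite -(jU y z) // setUC (jU z y) // e_sym.
have sU : {subset x :: p <= U} by move=> z zs; apply: AU; rewrite -defA inE.
have jp : all [pred z | (z \in U) && (j z == j x)] (x :: p).
  have /= : path e x p by move: cyc; rewrite /= rcons_path => /andP[].
  elim: (p) x sU {cyc un defA sz jU} => [|z q IHq] y sU /=.
    by rewrite sU ?inE ?eqxx.
  move=> /andP[eyz pth]; have Uy : y \in U by rewrite sU ?inE ?eqxx.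
  have Uz : z \in U by rewrite sU ?inE ?eqxx ?orbT.
  rewrite Uy eqxx (jE _ _ Uy Uz eyz); apply: IHq => //.
  by move=> t tq; rewrite sU // inE tq orbT.
exists (j x), (x :: p); split=> //; rewrite /ucycle un andbT.
apply: sub_in_cycle jp cyc => y z /andP[Uy /eqP jy] /andP[Uz _] /= eyz.
by rewrite /color_graph /= eyz jU // jy eqxx.
Qed.

End TwoColored.

(** * Assembling the partition *)

Theorem theorem11 (T : finType) (e : rel T) (c : {set T} -> bool)
    (e_sym : symmetric e) (e_irr : irreflexive e) :
  exists P : {set {set T}},
    [/\ partition P [set: T],
        #|P| <= 2 * alpha e &
        forall A : {set T}, A \in P ->
          [\/ is_edge e A,
              exists x, A = [set x],
              exists k, spanned_by_connected_matching (color_graph e c k) A |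
              exists k, has_spanning_cycle (color_graph e c k) A]].
Proof.
have [J leJ covJ] := components_cover c e_sym e_irr.
pose component k := root (color_graph e c k).
pose H := [set m | is_edge e m & [forall x in m, (c m, component (c m) x) \in J]].
pose matching (M : {set {set T}}) := (M \subset H) && trivIset M.
have [|M /maxsetP[/andP[/subsetP MH tM] Mmax] _] :=
    @maxset_exists _ matching set0.
  by rewrite /matching sub0set; apply/trivIsetP=> A; rewrite inE.
have edgeM m : m \in M -> exists x y, e x y /\ m = [set x; y].
  move/MH; rewrite inE => /andP[/existsP[x /existsP[y /andP[exy /eqP->]]] _].
  by exists x, y.
have edge_pblock x : x \in cover M -> pblock M x \in M by apply: pblock_mem.
(* Colour and component of the matching edge through [x]; meaningful only on [cover M]. *)
pose lab x := (c (pblock M x), component (c (pblock M x)) x).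
have labM m : m \in M -> {in m &, forall y z, lab y = lab z}.
  move=> Mm; suff lab_eq : exists l, {in m, forall y, lab y = l}.
    by case: lab_eq => l lab_l y z /lab_l-> /lab_l->.
  have [a [b [eab def_m]]] := edgeM _ Mm.
  exists (c m, component (c m) a) => y my; rewrite /lab (def_pblock tM Mm my).
  move: my; rewrite def_m !inE => /pred2P[]-> //.
  by rewrite /component (component_edge c e_sym eab).
pose Q := preim_partition lab (cover M).
have leQ : #|Q| <= alpha e.
  apply: leq_trans leJ.
  (* Each block of [Q] is the fibre of a label in [J], so there are at most [#|J|] blocks. *)
  apply: leq_trans (leq_imset_card (fun l => [set y in cover M | l == lab y]) _).
  apply/subset_leq_card/subsetP=> _ /imsetP[x Mx ->]; apply: imset_f.
  have := MH _ (edge_pblock _ Mx); rewrite inE => /andP[_ /'forall_implyP].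
  by apply; rewrite mem_pblock.
have uncovered x y : x \notin cover M -> y \notin cover M -> e x y ->
    (c [set x; y], component (c [set x; y]) x) \notin J.
  move=> Mx My exy; apply/negP=> inJ.
  suff defM : [set x; y] |: M = M.
    case/bigcupP: Mx; exists [set x; y]; last exact: set21.
    by rewrite -defM setU11.
  apply: Mmax (subsetUr _ _); apply/andP; split.
    rewrite subUset sub1set; apply/andP; split; last exact/subsetP.
    rewrite inE; apply/andP; split.
      by apply/existsP; exists x; apply/existsP; exists y; rewrite exy /=.
    apply/'forall_implyP=> z; rewrite !inE => /pred2P[]-> //.
    by rewrite /component -(component_edge c e_sym exy).
  apply: (proj1 (trivIsetU1 _ tM _)) => [m Mm|].
    rewrite disjoints_subset subUset !sub1set !inE.
    by apply/andP; split; [apply: contraNN Mx | apply: contraNN My] => zm;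
      apply/bigcupP; exists m.
  by apply/negP=> /edgeM[a [b [_ /setP/(_ a)]]]; rewrite !inE eqxx.
have [P [I [partP subI indI leP Pok]]] := posa e_sym e_irr (~: cover M).
exists (Q :|: P); split.
- rewrite -(setUCr (cover M)); apply: partition_setU => //.
    by rewrite disjoints_subset setCK.
  exact: preim_partitionP.
- rewrite mul2n -addnn (leq_trans (leq_card_setU _ _).1) // leq_add //.
  exact: leq_trans leP (leq_alpha indI).
move=> A; rewrite inE => /orP[/imsetP[x Mx defA] | PA].
  constructor 3; exists (lab x).1.
  have AP y : y \in A -> y \in cover M /\ lab y = lab x.
    by rewrite defA inE => /andP[-> /eqP].
  (* Labels are constant on each matching edge, so the edge through a vertex of [A] stays inside
     [A]. *)
  have coverA : cover [set m in M | m \subset A] = A.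
    apply/setP=> y; apply/bigcupP/idP=> [[m]|Ay].
      by rewrite inE => /andP[_ /subsetP]; apply.
    have [My laby] := AP y Ay.
    exists (pblock M y); rewrite ?mem_pblock // inE edge_pblock //=.
    apply/subsetP=> z yz.
    have Mz : z \in cover M by apply/bigcupP; exists (pblock M y); rewrite ?edge_pblock.
    rewrite defA inE Mz -laby /=; apply/eqP/(labM _ (edge_pblock _ My)) => //.
    by rewrite mem_pblock.
  exists [set m in M | m \subset A]; split=> //; split.
    split=> [m|]; last by apply: trivIsetS tM; apply/subsetP=> m; rewrite inE => /andP[].
    rewrite inE => /andP[Mm /subsetP mA]; have [a [b [eab def_m]]] := edgeM _ Mm.
    have ma : a \in m by rewrite def_m set21.
    apply/existsP; exists a; apply/existsP; exists b; rewrite /color_graph /= eab -def_m eqxx andbT.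
    by have [_ [<- _]] := AP a (mA a ma); rewrite (def_pblock tM Mm ma) eqxx.
  rewrite coverA => y z /AP[_ laby] /AP[_ labz]; apply/(component_eqP _ e_sym).
  have [ky ry] := laby; have [kz rz] := labz.
  by move: ry rz; rewrite /component ky kz => -> ->.
have subA : A \subset ~: cover M.
  by have /and3P[/eqP<- _ _] := partP; apply: bigcup_sup PA.
case: (Pok A PA) => [edgeA|sA|cycA]; [by constructor 1 | by constructor 2 |].
constructor 4.
(* If the red component of [x] is in [J], its edges to uncovered vertices are blue; otherwise its
   blue component is in [J] and they are red. *)
pose j x := (true, component true x) \notin J.
apply: (spanning_cycle_color (j := j) e_sym _ subA cycA) => x y.
rewrite !inE => Mx My exy; have := uncovered x y Mx My exy; rewrite /j.
case: (c _) => [->//|] xJ; apply/esym/negbF.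
by have [[] //] := covJ x; rewrite /component /= (negPf xJ).
Qed.
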